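(* Let $(\mathcal{X},\mathfrak{X})$, $(\mathcal{Y},\mathfrak{Y})$ be measurable spaces, let $\mu,\nu$ be finite measures on $(\mathcal{X}\times\mathcal{Y},\mathfrak{X}\times\mathfrak{Y})$, and let $\xi$ be a finite measure with $\xi\ll\mu+\nu$. Then for every $\epsilon>0$ there exist a finite sub-$\sigma$-algebra $\mathfrak{C}$ of $\mathfrak{X}$ and a finite sub-$\sigma$-algebra $\mathfrak{D}$ of $\mathfrak{Y}$ such that \[ \xi\bigl\{d_{\mathbb{H}}\bigl([\mathrm{d}\mu|_{\mathfrak{F}}:\mathrm{d}\nu|_{\mathfrak{F}}],[\mathrm{d}\mu:\mathrm{d}\nu]\bigr)\ge\epsilon\bigr\}<\epsilon \] for every $\sigma$-algebra $\mathfrak{F}$ with $\mathfrak{C}\times\mathfrak{D}\subseteq\mathfrak{F}\subseteq\mathfrak{X}\times\mathfrak{Y}$.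
   Context: The half projective line $\mathbb{H}$ is the set of rays $[r:s]=\{t(r,s):t>0\}$ for $(r,s)\in[0,\infty)^2\setminus\{(0,0)\}$, with metric $d_{\mathbb{H}}([r_1:s_1],[r_2:s_2])=|r_1/(r_1+s_1)-r_2/(r_2+s_2)|$. For finite measures $\alpha,\beta$ on a measurable space, the likelihood ratio is the $\mathbb{H}$-valued function $[\mathrm{d}\alpha:\mathrm{d}\beta]:=[\mathrm{d}\alpha/\mathrm{d}(\alpha+\beta):\mathrm{d}\beta/\mathrm{d}(\alpha+\beta)]$, defined $(\alpha+\beta)$-a.e. For a sub-$\sigma$-algebra $\mathfrak{F}$, $\mu|_{\mathfrak{F}}$ denotes the restriction of $\mu$ to $\mathfrak{F}$, so $[\mathrm{d}\mu|_{\mathfrak{F}}:\mathrm{d}\nu|_{\mathfrak{F}}]$ is the likelihood ratio of the restricted measures (an $\mathfrak{F}$-measurable function on $\mathcal{X}\times\mathcal{Y}$). *)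

(* Defs.v *)
From HB Require Import structures.
From mathcomp Require Import all_boot all_order all_algebra.
From mathcomp Require Import all_classical all_reals all_analysis.
Set Implicit Arguments. Unset Strict Implicit. Unset Printing Implicit Defensive.
Import Order.TTheory GRing.Theory Num.Theory.
Local Open Scope classical_set_scope.
Local Open Scope ring_scope.

Definition is_sub_sigma_algebra d (T : measurableType d) (F : set (set T)) : Prop :=
  sigma_algebra setT F /\ F `<=` measurable.

Definition prod_salg (X Y : Type) (C : set (set X)) (D : set (set Y))
  : set (set (X * Y)) :=
  <<s [set Z | exists A B, C A /\ D B /\ Z = A `*` B] >>.

(* Half projective line: a ray [r:s] is represented by a pair (r,s) of
   nonnegative reals, not both zero; the metric is
   d_H([r1:s1],[r2:s2]) = |r1/(r1+s1) - r2/(r2+s2)| (independent of the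
   representatives). *)
Definition dH (R : realType) (p q : R * R) : R :=
  `| p.1 / (p.1 + p.2) - q.1 / (q.1 + q.2) |.

Definition RN_deriv_on d (T : measurableType d) (R : realType)
  (F : set (set T)) (alpha : set T -> \bar R)
  (beta : {measure set T -> \bar R}) (g : T -> R) : Prop :=
  [/\ (forall B : set R, measurable B -> F (g @^-1` B)),
      (forall t, 0 <= g t) &
      (forall A, F A -> alpha A = (\int[beta]_(t in A) (g t)%:E)%E)].

Definition likelihood_ratio_on d (T : measurableType d) (R : realType)
  (F : set (set T)) (mu nu : {measure set T -> \bar R}) (f g : T -> R) : Prop :=
  RN_deriv_on F mu (measure_add mu nu) f /\
  RN_deriv_on F nu (measure_add mu nu) g.

(* Main.v *)
Require Import Defs.
From HB Require Import structures.
From mathcomp Require Import all_boot all_order all_algebra finmap.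
From mathcomp Require Import all_classical all_reals all_analysis.
From mathcomp Require Import measurable_realfun.
Import Order.TTheory GRing.Theory Num.Theory.
Import HBSimple.
Local Open Scope classical_set_scope.
Local Open Scope ring_scope.

(** Let [la = mu + nu]. Almost everywhere [f + g = 1] and [fF + gF = 1], so the
    distance between the two likelihood ratios is [`|fF - f|], where [fF] is the
    conditional expectation of [f] given [F] under [la]. Functions that are
    constant on the cells of a finite measurable grid are dense in [L^1(la)];
    take such an [h] close to [f] and let [C], [D] be generated by the sides of
    its grid. Since [h] is [F]-measurable and conditional expectation contracts
    [L^1], [fF] is as close to [h] as [f] is, hence close to [f]. Markov's
    inequality bounds the [la]-measure of the exceptional set, and absolute
    continuity transfers the bound to [xi]. *)

(** * Measurability with respect to a sub-sigma-algebra *)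

Lemma measurable_fun_sub_salg {R : realType} {d : measure_display}
    {T : measurableType d} {F : set (set T)} {u : T -> R} :
  F `<=` measurable -> (forall B : set R, measurable B -> F (u @^-1` B)) ->
  measurable_fun setT u.
Proof. by move=> Fm Fu _ B mB; rewrite setTI; apply: Fm; exact: Fu. Qed.

(** Since [F] is a bare set of sets, measurability for [F] is stated through preimages. This
    equivalence moves it to the type [g_sigma_algebraType F], where closure properties of measurable
    functions (sums, comparisons, constants) become available. *)
Lemma g_salg_measurable_fun {R : realType} {T : pointedType} {F : set (set T)}
    {u : T -> R} : sigma_algebra setT F ->
  measurable_fun (setT : set (g_sigma_algebraType F)) u <->
  (forall B : set R, measurable B -> F (u @^-1` B)).
Proof.
move=> sF; have FE : <<s F >> = F by exact: sigma_algebra_id.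
split=> [mu B mB|Fu _ B mB].
  by rewrite -FE -[_ @^-1` _]setTI; exact: mu.
by rewrite setTI; apply: sub_sigma_algebra; exact: Fu.
Qed.

(** * The L^1 distance and the contraction property of conditional expectation *)

Definition l1dist {R : realType} {d : measure_display} {T : measurableType d}
  (m : {measure set T -> \bar R}) (f g : T -> R) : \bar R :=
  (\int[m]_x `|f x - g x|%:E)%E.

Section l1dist_theory.
Context {R : realType} {d : measure_display} {T : measurableType d}.
Variable m : {measure set T -> \bar R}.
Implicit Types f g h : T -> R.

Lemma measurable_dist f g :
  measurable_fun setT f -> measurable_fun setT g ->
  measurable_fun setT (fun x => `|f x - g x|).
Proof.
by move=> mf mg; apply: measurableT_comp => //; exact: measurable_funB.
Qed.

Lemma l1dist_triangle g f h :
  measurable_fun setT f -> measurable_fun setT g -> measurable_fun setT h ->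
  (l1dist m f h <= l1dist m f g + l1dist m g h)%E.
Proof.
move=> mf mg mh; rewrite /l1dist -ge0_integralD//=; first last.
- exact/measurable_EFinP/measurable_dist.
- exact/measurable_EFinP/measurable_dist.
apply: ge0_le_integral => //.
- exact/measurable_EFinP/measurable_dist.
- by apply: emeasurable_funD; exact/measurable_EFinP/measurable_dist.
- by move=> x _; rewrite -EFinD lee_fin ler_distD.
Qed.

Lemma l1distxx f : l1dist m f f = 0%E.
Proof.
rewrite /l1dist; under eq_integral do rewrite subrr normr0.
by rewrite integral0.
Qed.

Lemma l1distC f g : l1dist m f g = l1dist m g f.
Proof. by apply: eq_integral => x _; rewrite distrC. Qed.

Lemma l1dist_markov f g (e : R) : 0 < e ->
  measurable_fun setT f -> measurable_fun setT g ->
  (e%:E * m [set x | (e <= `|f x - g x|)%R] <= l1dist m f g)%E.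
Proof.
move=> e0 mf mg.
have := @le_integral_comp_abse _ _ _ m _ measurableT
  (fun x => (f x - g x)%:E) e id (@measurable_id _ _ _)
  (fun _ => id) (fun _ _ _ _ => id).
rewrite setTI; apply => //.
by apply/measurable_EFinP; exact: measurable_funB.
Qed.

Lemma l1dist_add f g f' g' :
  measurable_fun setT f -> measurable_fun setT g ->
  measurable_fun setT f' -> measurable_fun setT g' ->
  (l1dist m (fun x => f x + g x)%R (fun x => f' x + g' x)%R <=
   l1dist m f f' + l1dist m g g')%E.
Proof.
move=> mf mg mf' mg'; rewrite /l1dist -ge0_integralD//=; first last.
- exact/measurable_EFinP/measurable_dist.
- exact/measurable_EFinP/measurable_dist.
apply: ge0_le_integral => //.
- by apply/measurable_EFinP/measurable_dist; exact: measurable_funD.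
- by apply: emeasurable_funD; exact/measurable_EFinP/measurable_dist.
- move=> x _; rewrite -EFinD lee_fin.
  by rewrite opprD addrACA ler_normD.
Qed.

Lemma l1dist_scale (c : R) f g :
  measurable_fun setT f -> measurable_fun setT g ->
  l1dist m (fun x => c * f x) (fun x => c * g x) = (`|c|%:E * l1dist m f g)%E.
Proof.
move=> mf mg; rewrite /l1dist -ge0_integralZl_EFin//.
- by apply: eq_integral => x _; rewrite -mulrBr normrM EFinM.
- exact/measurable_EFinP/measurable_dist.
Qed.

Lemma measurable_neq_fun f g :
  measurable_fun setT f -> measurable_fun setT g ->
  measurable [set x | f x != g x].
Proof.
move=> mf mg.
have -> : [set x | f x != g x] = setT `&` [set x | (f x)%:E != (g x)%:E].
  by rewrite setTI; apply/seteqP; split => x /=; rewrite eqe.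
by apply: measurable_neqe => //; exact/measurable_EFinP.
Qed.

Lemma l1dist_eq0 f g : measurable_fun setT f -> measurable_fun setT g ->
  l1dist m f g = 0%E -> m [set x | f x != g x] = 0%E.
Proof.
move=> mf mg fg0.
have mB : measurable_fun setT (fun x => (f x - g x)%:E : \bar R).
  by apply/measurable_EFinP; exact: measurable_funB.
have /(ae_eq_integral_abs m measurableT mB) :
    (\int[m]_x `|(f x - g x)%:E|)%E = 0%E.
  exact: fg0.
move=> [N [mN mN0 fgN]]; apply/eqP; rewrite -measure_le0 -mN0.
apply: le_measure; rewrite ?inE//.
  exact: measurable_neq_fun.
apply: subset_trans fgN => x /= /eqP fg /(_ Logic.I)[] /eqP.
by rewrite subr_eq0 => /eqP.
Qed.

(** The function [u] stands for the conditional expectation of [f] given [F], entering only through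
    its [F]-measurability and its integrals over sets of [F]. The sign of [u - h] is constant on a
    set of [F] and on its complement. On each of the two, the integral of [u - h] or [h - u] is
    unchanged when [u] is replaced by [f], and is then at most that of [|f - h|]. *)
Lemma l1dist_conditional_le (F : set (set T)) u h f :
  is_sub_sigma_algebra F ->
  (forall B : set R, measurable B -> F (u @^-1` B)) ->
  (forall B : set R, measurable B -> F (h @^-1` B)) ->
  m.-integrable setT (EFin \o u) -> m.-integrable setT (EFin \o h) ->
  m.-integrable setT (EFin \o f) ->
  (forall A, F A -> \int[m]_(x in A) (u x)%:E = \int[m]_(x in A) (f x)%:E)%E ->
  (l1dist m u h <= l1dist m f h)%E.
Proof.
move=> [sF Fm] Fu Fh iu ih if_ uf.
have iB A v w : measurable A -> m.-integrable setT (EFin \o v) ->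
    m.-integrable setT (EFin \o w) ->
    m.-integrable A (fun x => (v x)%:E - (w x)%:E)%E.
  move=> mA iv iw; apply: (@integrableS _ _ _ _ setT) => //.
  exact: (integrableB _ iv iw).
have mR v : m.-integrable setT (EFin \o v) -> measurable_fun setT v.
  by move=> /measurable_int/measurable_EFinP.
have mdist A v w : m.-integrable setT (EFin \o v) ->
    m.-integrable setT (EFin \o w) ->
    measurable_fun A (fun x => `|v x - w x|%:E : \bar R).
  move=> /mR mv /mR mw; apply: measurable_funTS.
  exact/measurable_EFinP/measurable_dist.
have iS A v : measurable A -> m.-integrable setT (EFin \o v) ->
    m.-integrable A (EFin \o v).
  by move=> mA; apply: integrableS.
have EB A v w : measurable A -> m.-integrable setT (EFin \o v) ->
    m.-integrable setT (EFin \o w) ->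
    (\int[m]_(x in A) ((v x)%:E - (w x)%:E) =
     \int[m]_(x in A) (v x)%:E - \int[m]_(x in A) (w x)%:E)%E.
  by move=> mA iv iw; apply: integralB_EFin => //; exact: iS.
have le1 A : F A ->
    (\int[m]_(x in A) ((u x)%:E - (h x)%:E) <=
     \int[m]_(x in A) `|f x - h x|%:E)%E.
  move=> FA; have mA := Fm _ FA.
  rewrite (_ : (\int[m]_(x in A) _ =
    \int[m]_(x in A) ((f x)%:E - (h x)%:E))%E); last first.
    by rewrite (EB _ _ _ mA iu ih) (EB _ _ _ mA if_ ih) uf.
  apply: (le_trans (lee_abs _)).
  exact: (le_trans (le_abse_integral _ mA
    (measurable_int _ (iB _ _ _ mA if_ ih)))).
have le2 A : F A ->
    (\int[m]_(x in A) ((h x)%:E - (u x)%:E) <=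
     \int[m]_(x in A) `|f x - h x|%:E)%E.
  move=> FA; have mA := Fm _ FA.
  rewrite (_ : (\int[m]_(x in A) _ =
    \int[m]_(x in A) ((h x)%:E - (f x)%:E))%E); last first.
    by rewrite (EB _ _ _ mA ih iu) (EB _ _ _ mA ih if_) uf.
  apply: (le_trans (lee_abs _)).
  apply: (le_trans (le_abse_integral _ mA
    (measurable_int _ (iB _ _ _ mA ih if_)))).
  by under eq_integral do rewrite -EFinB/= distrC.
(* Both [u] and [h] are [F]-measurable, so [S] and its complement lie in [F]: [le1] handles the
   first, [le2] the second. *)
pose S := [set x | h x <= u x].
have FS : F S.
  rewrite -(sigma_algebra_id sF) -[S]setTI.
  by apply: (@measurable_fun_le _ (g_sigma_algebraType F)) => //;
    exact/(g_salg_measurable_fun sF).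
have FSC : F (~` S) by rewrite -setTD; case: sF => _ + _; apply.
have [mS mSC] := (Fm _ FS, Fm _ FSC).
have dS : [disjoint S & ~` S] by apply/disj_setPS => x [].
rewrite /l1dist -(setUv S) !ge0_integral_setU//; [|exact: mdist..].
apply: leeD.
- apply: le_trans (le1 _ FS); rewrite le_eqVlt; apply/orP; left; apply/eqP.
  apply: eq_integral => x; rewrite inE/= => hu.
  by rewrite ger0_norm ?subr_ge0.
- apply: le_trans (le2 _ FSC); rewrite le_eqVlt; apply/orP; left; apply/eqP.
  apply: eq_integral => x; rewrite inE/= => /negP; rewrite -ltNge => uh.
  by rewrite distrC ger0_norm ?subr_ge0// ltW.
Qed.

End l1dist_theory.

(** * Absolute continuity in epsilon-delta form *)

Lemma null_dominates_delta {R : realType} {d : measure_display}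
  {T : measurableType d} (m : {measure set T -> \bar R})
  (xi : {finite_measure set T -> \bar R}) :
  xi `<< m -> forall eps : R, 0 < eps -> exists2 delta : R, 0 < delta &
  forall A, measurable A -> (m A < delta%:E)%E -> (xi A < eps%:E)%E.
Proof.
move=> dom eps eps0; apply: contrapT => /forall2NP nd.
(* If no [delta] works, testing the powers [1 / 2^(n+1)] gives sets of summable [m]-measure whose
   [xi]-measure stays at least [eps]. *)
have ex n : exists A, [/\ measurable A, (m A < (1 / (2 ^ n.+1)%:R)%:E)%E &
    (eps%:E <= xi A)%E].
  have [|/existsNP[A /not_implyP[mA /not_implyP[mA1 /negP]]]] :=
    nd (1 / (2 ^ n.+1)%:R).
    by case; rewrite divr_gt0// ltr0n expn_gt0.
  by rewrite -leNgt => xiA; exists A.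
have [F F_] := choice ex.
have mF k : measurable (F k) by case: (F_ k).
(* Borel-Cantelli: the measures sum to at most 1, so the upper limit of the sets is null for [m],
   hence for [xi]. *)
have mF0 : m (lim_sup_set F) = 0%E.
  apply: lim_sup_set_cvg0 => //.
  apply: (@le_lt_trans _ _ 1%:E); last by rewrite ltry.
  apply: le_trans (epsilon_trick0 xpredT ler01).
  by apply: lee_nneseries => // n _; rewrite ltW//; case: (F_ n).
have mbF n : measurable (\bigcup_(k >= n) F k) by exact: bigcup_measurable.
have xiF0 : xi (lim_sup_set F) = 0%E.
  by move/null_content_dominatesP: dom; apply => //; exact: bigcapT_measurable.
(* Continuity from above, valid because [xi] is finite: the tail unions all have [xi]-measure at
   least [eps], so their limit cannot have measure 0. *)
have xicvg : xi (\bigcup_(k >= n) F k) @[n --> \oo] --> xi (lim_sup_set F).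
  by apply: lim_sup_set_cvg => //; rewrite ltey_eq fin_num_measure.
have : (eps%:E <= xi (lim_sup_set F))%E.
  apply: (cvge_to_ge xicvg).
  apply: nearW => n; have [_ _ /le_trans] := F_ n; apply.
  by apply: le_measure; rewrite ?inE//; apply: bigcup_sup => /=.
by rewrite xiF0 lee_fin leNgt eps0.
Qed.

(** * Functions constant on the cells of a finite measurable grid *)

Section grid_functions.
Context {R : realType} {d1 d2 : measure_display}
  {X : measurableType d1} {Y : measurableType d2}.
Implicit Types h : X * Y -> R.

(** The grid is encoded by labelling maps [p] and [q] into finite types instead of by lists of
    cells. Cells may then be empty, and a common refinement is just a pairing of labels. *)
Definition grid_fun h : Prop :=
  exists (T1 T2 : finType) (p : X -> T1) (q : Y -> T2) (k : T1 * T2 -> R),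
    [/\ forall S : set T1, measurable (p @^-1` S),
        forall S : set T2, measurable (q @^-1` S) &
        h = fun z => k (p z.1, q z.2)].

Lemma grid_fun_scale (c : R) h : grid_fun h -> grid_fun (fun z => c * h z).
Proof.
move=> [T1 [T2 [p [q [k [mp mq ->]]]]]].
by exists T1, T2, p, q, (fun t => c * k t).
Qed.

Lemma measurable_pair_fin (d : measure_display) (T : measurableType d)
    (T1 T2 : finType) (p : T -> T1) (p' : T -> T2) :
  (forall S : set T1, measurable (p @^-1` S)) ->
  (forall S : set T2, measurable (p' @^-1` S)) ->
  forall S : set (T1 * T2), measurable ((fun x => (p x, p' x)) @^-1` S).
Proof.
move=> mp mp' S.
rewrite (_ : _ @^-1` S =
  \bigcup_(t in S) (p @^-1` [set t.1] `&` p' @^-1` [set t.2])).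
  apply: fin_bigcup_measurable => [|t _]; first exact: finite_finset.
  exact: measurableI.
apply/seteqP; split=> [x Sx|x [[t1 t2] St [/= -> ->]]]//.
by exists (p x, p' x).
Qed.

(** The sum is constant on the cells of the common refinement of the two grids, labelled by
    pairs. *)
Lemma grid_fun_add h h' :
  grid_fun h -> grid_fun h' -> grid_fun (fun z => h z + h' z).
Proof.
move=> [T1 [T2 [p [q [k [mp mq ->]]]]]] [T1' [T2' [p' [q' [k' [mp' mq' ->]]]]]].
exists (T1 * T1')%type, (T2 * T2')%type, (fun x => (p x, p' x)),
  (fun y => (q y, q' y)),
  (fun t => k (t.1.1, t.2.1) + k' (t.1.2, t.2.2)).
by split=> // S; exact: measurable_pair_fin.
Qed.

Lemma measurable_preimage_mem (d : measure_display) (T : measurableType d)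
    (A : set T) (S : set bool) :
  measurable A -> measurable ((fun x => x \in A) @^-1` S).
Proof.
move=> mA; rewrite -[_ @^-1` _]setTI.
by apply: (measurable_fun_bool true) => //; rewrite setTI preimage_mem_true.
Qed.

Lemma grid_fun_rectangle (A : set X) (B : set Y) :
  measurable A -> measurable B -> grid_fun (\1_(A `*` B)).
Proof.
move=> mA mB; exists bool, bool, (fun x => x \in A), (fun y => y \in B),
  (fun t => (t.1 && t.2)%:R).
split=> [S|S|]; [exact: measurable_preimage_mem..|].
by apply/funext => z/=; rewrite indicE in_setX.
Qed.

(** Preimage commutes with complements and countable unions, so these sets form a sigma-algebra as
    they stand. There are finitely many because a finite type has finitely many subsets. *)
Lemma preimage_fin_salg (d : measure_display) (T : measurableType d)
    (T1 : finType) (p : T -> T1) :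
  (forall S : set T1, measurable (p @^-1` S)) ->
  is_sub_sigma_algebra [set p @^-1` S | S in setT] /\
  finite_set [set p @^-1` S | S in setT].
Proof.
move=> mp; split; last first.
  apply: finite_image.
  (* Finiteness of the powerset is carried over from the finite type [{set T1}], which maps onto
     [set T1]. *)
  have -> : [set: set T1] = (fun A : {set T1} => [set x | x \in A]) @` setT.
    apply/seteqP; split=> // S _; exists [set x | x \in S]%SET => //.
    by apply/seteqP; split=> x /=; rewrite !inE.
  apply: finite_image; exact: finite_finset.
split; last by move=> _ [S _ <-]; exact: mp.
split.
- by exists set0 => //; rewrite preimage_set0.
- by move=> _ [S _ <-]; exists (~` S) => //; rewrite setTD preimage_setC.
- move=> A /(_ _)/cid2-/all_sig2[S _ AS].
  exists (\bigcup_k S k) => //; rewrite preimage_bigcup.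
  by apply: eq_bigcupr => k _.
Qed.

(** This produces the [C] and [D] of the theorem. A preimage under [h] is a finite union of cells,
    each of them a product of a set of [C] and a set of [D]. *)
Lemma grid_fun_salg h : grid_fun h ->
  exists (C : set (set X)) (D : set (set Y)),
  [/\ is_sub_sigma_algebra C /\ finite_set C,
      is_sub_sigma_algebra D /\ finite_set D &
      forall B : set R, prod_salg C D (h @^-1` B)].
Proof.
move=> [T1 [T2 [p [q [k [mp mq ->]]]]]].
exists [set p @^-1` S | S in setT], [set q @^-1` S | S in setT].
split; [exact: preimage_fin_salg..|move=> B].
rewrite (_ : _ @^-1` B = \bigcup_(t in k @^-1` B)
    ((p @^-1` [set t.1]) `*` (q @^-1` [set t.2]))); last first.
  apply/seteqP; split=> [z Bz|z [[t1 t2] /= Bt [/= -> ->]]]//.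
  by exists (p z.1, q z.2).
pose G := [set Z | exists A B, [set p @^-1` S | S in setT] A /\
  [set q @^-1` S | S in setT] B /\ Z = A `*` B].
apply: (@fin_bigcup_measurable _ (g_sigma_algebraType G)).
  exact: finite_finset.
move=> t _; apply: sub_sigma_algebra.
exists (p @^-1` [set t.1]), (q @^-1` [set t.2]).
by split; [exists [set t.1]|split=> //; exists [set t.2]].
Qed.

Lemma prod_salg_measurable (C : set (set X)) (D : set (set Y)) :
  C `<=` measurable -> D `<=` measurable -> prod_salg C D `<=` measurable.
Proof.
move=> Cm Dm; apply: smallest_sub; first exact: sigma_algebra_measurable.
by move=> _ [A [B [CA [DB ->]]]]; apply: measurableX; [exact: Cm|exact: Dm].
Qed.

Lemma measurable_grid_fun h : grid_fun h -> measurable_fun setT h.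
Proof.
move=> /grid_fun_salg[C [D [[[_ Cm] _] [[_ Dm] _] hCD]]] _ B _.
by rewrite setTI; exact: (prod_salg_measurable _ _ Cm Dm).
Qed.

Lemma integrable_grid_fun (m : {measure set (X * Y) -> \bar R}) h :
  (m setT < +oo)%E -> grid_fun h -> m.-integrable setT (EFin \o h).
Proof.
move=> moo gh; apply: measurable_bounded_integrable => //.
  exact: measurable_grid_fun.
case: gh => [T1 [T2 [p [q [k [mp mq ->]]]]]].
(* A grid function takes finitely many values, and the sum of their absolute values bounds each of
   them. *)
exists (\sum_t `|k t|); split; first exact: num_real.
move=> M kM z _ /=; apply: le_trans (ltW kM).
by rewrite (bigD1 (p z.1, q z.2))//= lerDl sumr_ge0.
Qed.

End grid_functions.

(** * Density of the grid functions in L^1 of a finite measure *)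

Section grid_approximation.
Context {R : realType} {d1 d2 : measure_display}
  {X : measurableType d1} {Y : measurableType d2}.
Variable m : {measure set (X * Y) -> \bar R}.
Hypothesis moo : (m setT < +oo)%E.
Implicit Types f h : X * Y -> R.

(** For measurable [f], this is membership in the L^1-closure of the grid functions. *)
Definition grid_approx f := forall e : R, 0 < e ->
  exists2 h, grid_fun h & (l1dist m f h < e%:E)%E.

Lemma grid_fun_approx h : grid_fun h -> grid_approx h.
Proof.
by move=> gh e e0; exists h; rewrite ?l1distxx.
Qed.

Lemma grid_approx_closed f : measurable_fun setT f ->
  (forall e : R, 0 < e -> exists f', [/\ measurable_fun setT f',
     grid_approx f' & (l1dist m f f' < e%:E)%E]) -> grid_approx f.
Proof.
move=> mf ap e e0; have e20 : 0 < e / 2 by rewrite divr_gt0.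
have [f' [mf' /(_ _ e20)[h gh f'h] ff']] := ap _ e20.
exists h => //; apply: le_lt_trans (l1dist_triangle m f' _ _ mf mf' _) _.
  exact: measurable_grid_fun.
by rewrite [e]splitr EFinD lteD.
Qed.

Lemma grid_approx_add f f' : measurable_fun setT f -> measurable_fun setT f' ->
  grid_approx f -> grid_approx f' -> grid_approx (fun z => f z + f' z).
Proof.
move=> mf mf' af af' e e0; have e20 : 0 < e / 2 by rewrite divr_gt0.
have [h gh fh] := af _ e20; have [h' gh' fh'] := af' _ e20.
exists (fun z => h z + h' z); first exact: grid_fun_add.
apply: le_lt_trans (l1dist_add m _ _ _ _ mf mf' _ _) _.
- exact: measurable_grid_fun.
- exact: measurable_grid_fun.
by rewrite [e]splitr EFinD lteD.
Qed.

Lemma grid_approx_scale (c : R) f : measurable_fun setT f ->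
  grid_approx f -> grid_approx (fun z => c * f z).
Proof.
(* Dividing by [|c| + 1] instead of [|c|] covers [c = 0]. *)
move=> mf af e e0; have c0 : 0 < `|c| + 1 by rewrite ltr_wpDl.
have [h gh fh] := af _ (divr_gt0 e0 c0).
exists (fun z => c * h z); first exact: grid_fun_scale.
rewrite l1dist_scale//; last exact: measurable_grid_fun.
apply: (@le_lt_trans _ _ (`|c|%:E * (e / (`|c| + 1))%:E)%E).
  by apply: lee_wpmul2l => //; exact: ltW.
by rewrite -EFinM lte_fin mulrCA gtr_pMr// ltr_pdivrMr// mul1r ltrDl.
Qed.

Lemma grid_approx_sum (I : Type) (r : seq I) (F : I -> X * Y -> R) :
  (forall i, measurable_fun setT (F i)) -> (forall i, grid_approx (F i)) ->
  grid_approx (fun z => \sum_(i <- r) F i z).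
Proof.
move=> mF aF; elim: r => [|i r ih].
  under eq_fun do rewrite big_nil.
  (* The empty sum is seen as a multiple of the indicator of the full rectangle, which is a grid
     function. *)
  have -> : (fun _ => 0) = (fun z => 0 * \1_(setT `*` setT) z) :> (X * Y -> R).
    by apply/funext => z; rewrite mul0r.
  apply: grid_approx_scale.
    by apply: measurable_indic; exact: measurableX.
  by apply: grid_fun_approx; exact: grid_fun_rectangle.
under eq_fun do rewrite big_cons.
by apply: grid_approx_add => //; exact: measurable_sum.
Qed.

(** By disjointness a point of [F n] lies in no later set, so each induction step moves exactly one
    indicator out of the tail. *)
Lemma indic_bigcup_tail (T : Type) (F : (set T)^nat) (n : nat) (z : T) :
  trivIset setT F ->
  \1_(\bigcup_k F k) z =
    \sum_(i < n) \1_(F i) z + \1_(\bigcup_(k >= n) F k) z :> R.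
Proof.
move=> tF; elim: n => [|n ->].
  by rewrite big_ord0 add0r; congr (\1_ _ z); apply: eq_bigcupl; split.
rewrite big_ord_recr/= -addrA; congr (_ + _).
have tailS : (z \in \bigcup_(k >= n) F k) =
    (z \in F n) || (z \in \bigcup_(k >= n.+1) F k).
  apply/idP/orP; rewrite !inE.
    move=> [k /= + Fkz]; rewrite leq_eqVlt => /predU1P[nk|nk].
      by left; rewrite nk.
    by right; exists k.
  by move=> [Fz|[k /= nk Fkz]]; [exists n => /=|exists k => //=; exact: ltnW].
rewrite !indicE tailS; case: (boolP (z \in F n)) => //=; last by rewrite add0r.
rewrite inE => Fnz.
suff -> : (z \in \bigcup_(k >= n.+1) F k) = false by rewrite addr0.
apply/negP; rewrite inE => -[k /= nk Fkz].
have kn := tF k n I I (ex_intro _ z (conj Fkz Fnz)).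
by rewrite kn ltnn in nk.
Qed.

(** The distance to the n-th partial sum is the measure of the tail union. The tails decrease to the
    upper limit of the sets, which is null since the measures add up to that of the union, a finite
    number. *)
Lemma l1dist_indic_bigcup_cvg0 (F : (set (X * Y))^nat) :
  (forall n, measurable (F n)) -> trivIset setT F ->
  l1dist m (\1_(\bigcup_k F k)) (fun z => \sum_(i < n) \1_(F i) z) @[n --> \oo]
    --> 0%E.
Proof.
move=> mF tF.
have mU : measurable (\bigcup_k F k) by exact: bigcupT_measurable.
have ltU : (m (\bigcup_k F k) < +oo)%E.
  by apply: le_lt_trans moo; apply: le_measure; rewrite ?inE.
have F0 : m (lim_sup_set F) = 0%E.
  by apply: lim_sup_set_cvg0 => //; rewrite -measure_semi_bigcup.
rewrite -F0.
have E n : l1dist m (\1_(\bigcup_k F k)) (fun z => \sum_(i < n) \1_(F i) z) =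
    m (\bigcup_(k >= n) F k).
  rewrite -[X in _ = m X]setIT -integral_indic//; last exact: bigcup_measurable.
  apply: eq_integral => z _; rewrite (indic_bigcup_tail _ _ n)// addrC addKr.
  by rewrite ger0_norm.
under eq_fun do rewrite E.
apply: lim_sup_set_cvg => //.
rewrite (_ : \bigcup_(k >= 0) F k = \bigcup_k F k)//.
by apply: eq_bigcupl; split.
Qed.

(** Dynkin's pi-lambda argument: rectangles are stable under intersection and generate the product
    sigma-algebra, while the sets with approximable indicator contain them and are closed under
    complement and disjoint countable union. *)
Lemma grid_approx_indic (A : set (X * Y)) :
  measurable A -> grid_approx (\1_A).
Proof.
move=> mA; have mE := @measurable_prod_measurableType _ _ X Y.
apply: (dynkin_induction (P := fun A => grid_approx (\1_A)) mE) => //.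
- move=> _ _ [A1 mA1 [B1 mB1 <-]] [A2 mA2 [B2 mB2 <-]].
  exists (A1 `&` A2); first exact: measurableI.
  by exists (B1 `&` B2); [exact: measurableI|rewrite setXI].
- by rewrite -setXTT; apply: grid_fun_approx; exact: grid_fun_rectangle.
- move=> _ [A1 mA1 [B1 mB1 <-]]; apply: grid_fun_approx.
  exact: grid_fun_rectangle.
- move=> S mS aS.
  have -> : \1_(~` S) =
      (fun z => \1_(setT `*` setT) z + -1 * \1_S z) :> (_ -> R).
    apply/funext => z; rewrite setXTT indicT/= !indicE in_setC.
    by case: (z \in S); rewrite ?mulr1 ?subrr// mulr0 addr0.
  apply: grid_approx_add.
  + by apply: measurable_indic; exact: measurableX.
  + by apply: measurable_funM => //; exact: measurable_indic.
  + by apply: grid_fun_approx; exact: grid_fun_rectangle.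
  + by apply: grid_approx_scale => //; exact: measurable_indic.
(* Finite partial sums are approximable and converge in L^1 to the indicator of the union. *)
- move=> F mF tF aF; apply: grid_approx_closed.
    by apply: measurable_indic; exact: bigcupT_measurable.
  move=> e e0.
  have /fine_cvgP[fin /cvgr0_norm_lt] := l1dist_indic_bigcup_cvg0 _ mF tF.
  move=> /(_ _ e0) lte.
  have [n [finn nlt]] := @filter_ex _ _ _ _ (filterI fin lte).
  exists (fun z => \sum_(i < n) \1_(F i) z); split.
  + by apply: measurable_sum => i; exact: measurable_indic.
  + apply: (grid_approx_sum _ _ (fun i : 'I_n => \1_(F i))) => i.
      exact: measurable_indic.
    exact: aF.
  + rewrite -[X in (X < _)%E]fineK// lte_fin; apply: le_lt_trans nlt.
    exact: ler_norm.
- by rewrite -mE.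
Qed.

(** Simple functions are L^1-dense among integrable ones, and each is a finite linear combination of
    indicators of measurable sets. *)
Lemma grid_approx_integrable f :
  m.-integrable setT (EFin \o f) -> grid_approx f.
Proof.
move=> intf; apply: grid_approx_closed.
  exact/measurable_EFinP/measurable_int/intf.
move=> e e0.
have [s [ints _ /fine_cvgP[fin /cvgr0_norm_lt]]] :=
  approximation_sfun_integrable measurableT intf.
move=> /(_ _ e0) lte.
have [n [finn nlt]] := @filter_ex _ _ _ _ (filterI fin lte).
exists (s n); split; first exact: measurable_funP.
- have -> : s n = (fun z => \sum_(y <- fset_set (range (s n)))
      (y * \1_(s n @^-1` [set y]) z)) :> (_ -> R).
    by apply/funext => z; rewrite fimfunE fsbig_finite.
  have ms y : measurable (s n @^-1` [set y]) by exact: measurable_sfunP.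
  apply: (grid_approx_sum _ _ (fun y z => y * \1_(s n @^-1` [set y]) z)) => y.
    by apply: measurable_funM => //; exact: measurable_indic.
  apply: grid_approx_scale; first exact: measurable_indic.
  exact: grid_approx_indic.
- rewrite -[X in (X < _)%E]fineK// lte_fin; apply: le_lt_trans nlt.
  exact: ler_norm.
Qed.

End grid_approximation.

(** * Integrability and normalization of likelihood ratios *)

Section likelihood_ratio.
Context {R : realType} {d : measure_display} {T : measurableType d}.
Implicit Types (F : set (set T)) (m : {measure set T -> \bar R}).

Lemma finite_measure_lty (mu : {finite_measure set T -> \bar R}) :
  (mu setT < +oo)%E.
Proof. by rewrite ltey_eq fin_num_measure. Qed.

Lemma measure_add_lty (mu nu : {finite_measure set T -> \bar R}) :
  (measure_add mu nu setT < +oo)%E.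
Proof.
by rewrite measure_addE lte_add_pinfty//; exact: finite_measure_lty.
Qed.

(** As [u] is nonnegative, its integrability amounts to finiteness of the total integral, which is
    [alpha setT]. *)
Lemma RN_deriv_integrable F (alpha : set T -> \bar R) m u :
  is_sub_sigma_algebra F -> (alpha setT < +oo)%E -> RN_deriv_on F alpha m u ->
  m.-integrable setT (EFin \o u).
Proof.
move=> [sF Fm] aoo [Fu u0 au]; apply/integrableP; split.
  exact/measurable_EFinP/(measurable_fun_sub_salg Fm Fu).
under eq_integral => x _ do rewrite /= ger0_norm//.
by rewrite -au//; have [F0 FC _] := sF; rewrite -(setD0 setT); exact: FC.
Qed.

(** Over every set of [F], both [f + g] and the constant 1 integrate to the mass of that set under
    [mu + nu]. The contraction lemma, with 1 as both the target and the conditioned function, bounds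
    the distance from [f + g] to 1 by that from 1 to itself. *)
Lemma likelihood_ratio_sum1 F (mu nu : {finite_measure set T -> \bar R}) f g :
  is_sub_sigma_algebra F -> likelihood_ratio_on F mu nu f g ->
  measure_add mu nu [set x | f x + g x != 1] = 0%E.
Proof.
move=> sF [rf rg]; have [saF Fm] := sF.
have if_ := RN_deriv_integrable _ _ _ _ sF (finite_measure_lty mu) rf.
have ig := RN_deriv_integrable _ _ _ _ sF (finite_measure_lty nu) rg.
case: rf rg => Ff f0 fE [Fg g0 gE].
have Ffg (B : set R) : measurable B -> F ((fun x => f x + g x) @^-1` B).
  move: B; apply/(g_salg_measurable_fun saF).
  by apply: measurable_funD; exact/(g_salg_measurable_fun saF).
have mfg := measurable_fun_sub_salg Fm Ffg.
apply: (l1dist_eq0 _ (fun x => f x + g x) (cst 1)) => //.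
apply/eqP; rewrite eq_le integral_ge0 ?andbT//.
rewrite -(l1distxx (measure_add mu nu) (cst 1)).
have i1 : (measure_add mu nu).-integrable setT (EFin \o (cst 1)).
  apply: measurable_bounded_integrable => //; first exact: measure_add_lty.
  by exists 1; split => // M M1 x _ /=; rewrite normr1 ltW.
apply: (l1dist_conditional_le _ F) => //.
- by apply/(g_salg_measurable_fun saF); exact: measurable_cst.
- exact: (integrableD _ if_ ig).
- move=> A FA; have mA := Fm _ FA.
  rewrite (_ : (\int[measure_add mu nu]_(x in A) (f x + g x)%:E =
    \int[measure_add mu nu]_(x in A) (f x)%:E +
    \int[measure_add mu nu]_(x in A) (g x)%:E)%E).
    have := integral_cst (measure_add mu nu) mA 1%E.
    by rewrite mul1e -fE// -gE// => ->; exact/esym/measure_addE.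
  have mFA v : (forall B : set R, measurable B -> F (v @^-1` B)) ->
      measurable_fun A (EFin \o v).
    move=> Fv; apply/measurable_EFinP/measurable_funTS.
    exact: (measurable_fun_sub_salg Fm Fv).
  by rewrite -ge0_integralD//; try (by move=> x _; rewrite lee_fin);
    exact: mFA.
Qed.

End likelihood_ratio.

(** On nonnegative reals inversion coincides with the power of exponent -1, also at 0 where both are
    0 by convention, so measurability of [powR] applies. *)
Lemma measurable_ratio {R : realType} {d : measure_display}
    {T : measurableType d} (f g : T -> R) :
  (forall x, 0 <= f x) -> (forall x, 0 <= g x) ->
  measurable_fun setT f -> measurable_fun setT g ->
  measurable_fun setT (fun x => f x / (f x + g x)).
Proof.
move=> f0 g0 mf mg; under eq_fun do rewrite -powR_inv1 ?addr_ge0//.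
apply: measurable_funM => //.
apply: (measurableT_comp (measurable_powR (-1))); exact: measurable_funD.
Qed.

(** * From the L^1 estimate to the exceptional set *)

Theorem theorem4 (R : realType) (d1 d2 : measure_display)
  (X : measurableType d1) (Y : measurableType d2)
  (mu nu xi : {finite_measure set (X * Y)%type -> \bar R})
  (hxi : xi `<< measure_add mu nu)
  (f g : (X * Y)%type -> R)
  (hfg : likelihood_ratio_on measurable mu nu f g) :
  forall eps : R, 0 < eps ->
  exists (C : set (set X)) (D : set (set Y)),
    is_sub_sigma_algebra C /\ finite_set C /\
    is_sub_sigma_algebra D /\ finite_set D /\
        forall F : set (set (X * Y)%type),
          is_sub_sigma_algebra F -> prod_salg C D `<=` F ->
          forall fF gF : (X * Y)%type -> R,
            likelihood_ratio_on F mu nu fF gF ->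
            (xi [set z | (eps <= dH (fF z, gF z) (f z, g z))%R] < eps%:E)%E.
Proof.
move=> eps eps0; pose la := measure_add mu nu : {measure set _ -> \bar R}.
have laoo : (la setT < +oo)%E by exact: measure_add_lty.
have [delta delta0 xid] := null_dominates_delta la xi hxi eps eps0.
have sM : @is_sub_sigma_algebra _ (X * Y)%type measurable.
  by split=> //; exact: sigma_algebra_measurable.
have [rf rg] := hfg.
have if_ := RN_deriv_integrable _ _ _ _ sM (finite_measure_lty mu) rf.
have mf : measurable_fun setT f by exact/measurable_EFinP/measurable_int/if_.
have mg : measurable_fun setT g.
  by case: rg => mg _ _ _ B mB; rewrite setTI; exact: mg.
(* The tolerance is used twice, for [f] to [h] and for [fF] to [h]. The total [eps * delta] is what
   Markov's inequality at level [eps] turns into [delta]. *)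
have [|h gh fh] := grid_approx_integrable la laoo f if_ (eps * delta / 2).
  by rewrite divr_gt0// mulr_gt0.
have mh := measurable_grid_fun _ gh.
have [C [D [[sC fC] [sD fD] hCD]]] := grid_fun_salg _ gh.
exists C, D; do 4 split=> //; move=> F sF CDF fF gF hF.
have [saF Fm] := sF; have [[FfF fF0 fFE] [FgF gF0 gFE]] := hF.
have ifF := RN_deriv_integrable _ _ _ _ sF (finite_measure_lty mu) hF.1.
have mfF := measurable_fun_sub_salg Fm FfF.
have mgF := measurable_fun_sub_salg Fm FgF.
(* Here [prod_salg C D] being contained in [F] makes [h] measurable for [F], and [fF] and [f] both
   integrate to [mu A] over every [A] in [F]. *)
have fFh : (l1dist la fF h <= l1dist la f h)%E.
  apply: (l1dist_conditional_le _ F) => //.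
  - by move=> B _; exact: CDF.
  - exact: integrable_grid_fun.
  - by move=> A FA; rewrite -fFE//; case: rf => _ _ ->//; exact: Fm.
have fFf : (l1dist la fF f < (eps * delta)%:E)%E.
  apply: le_lt_trans (l1dist_triangle la h _ _ mfF mh mf) _.
  rewrite [eps * delta]splitr EFinD lteD//; first exact: le_lt_trans fh.
  by rewrite l1distC.
pose E := [set z | eps <= `|fF z - f z|].
pose N := [set z | f z + g z != 1]; pose N' := [set z | fF z + gF z != 1].
have mE : measurable E.
  rewrite -[E]setTI; apply: measurable_fun_le => //; exact: measurable_dist.
have mN : measurable N.
  by apply: (measurable_neq_fun _ (cst 1)) => //; exact: measurable_funD.
have mN' : measurable N'.
  by apply: (measurable_neq_fun _ (cst 1)) => //; exact: measurable_funD.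
have laE : (la E < delta%:E)%E.
  rewrite -(@lte_pmul2l _ eps%:E)// -EFinM; apply: le_lt_trans fFf.
  exact: l1dist_markov.
have mZ : measurable [set z | eps <= dH (fF z, gF z) (f z, g z)].
  rewrite -[X in measurable X]setTI; apply: measurable_fun_le => //.
  case: rf rg => _ f0 _ [_ g0 _].
  by apply: measurable_dist; exact: measurable_ratio.
apply: xid => //; apply: le_lt_trans laE.
have laN : la N = 0%E by exact: likelihood_ratio_sum1 hfg.
have laN' : la N' = 0%E by exact: likelihood_ratio_sum1 hF.
(* Outside the null sets [N] and [N'] both denominators in [dH] equal 1, so the exceptional set is
   there contained in [E]. *)
apply: (@le_trans _ _ (la (E `|` (N `|` N')))).
  apply: le_measure; rewrite ?inE//.
    by apply: measurableU => //; exact: measurableU.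
  move=> z; rewrite /= /dH/=.
  have [fg1|fg1] := eqVneq (f z + g z) 1; last by right; left.
  have [fgF1|fgF1] := eqVneq (fF z + gF z) 1; last by right; right.
  by rewrite fg1 fgF1 !divr1; left.
rewrite measureU0//; first exact: measurableU.
have leNN' : (la (N `|` N') <= la N + la N')%E by exact: measureU2.
by apply/eqP; rewrite -measure_le0 (le_trans leNN')// laN laN' adde0.
Qed.
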